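(* Assume that $\Gamma(X)^T\Gamma(X)$ is almost surely invertible and that $\beta$ has a finite expectation $\bar\beta=\mathbb{E}\beta$. Let $m\le Cn$ for some constant $C$ and assume that $\rho(\bar\beta)\in L^p(\Omega)$ and $K_q(\Gamma)<+\infty$ for some $p\in[2,+\infty]$ and with $2p^{-1}+2q^{-1}=1$. Then there exists a constant $C(n)$, depending on $n$ (and on $C$ and $K_q(\Gamma)$) but not on $f$, such that $$\mathrm{Tr}(\mathrm{Cov}(\beta))\le C(n)\,\|\rho(\bar\beta)\|_{L^p(\Omega)}^2.$$
   Context: $(\Omega,\mu)$ is a probability space, $n,m\ge1$ are integers, and $f,\gamma_1,\dots,\gamma_n:\Omega\to\mathbb{R}$ are measurable functions. For $a\in\mathbb{R}^n$ the residue is $\rho(a)(x)=f(x)-\sum_{j=1}^n a_j\gamma_j(x)$. $X=(X^{(1)},\dots,X^{(m)})$ where $X^{(1)},\dots,X^{(m)}$ are i.i.d. random points of $\Omega$ with distribution $\mu$. $F(X)=(f(X^{(1)}),\dots,f(X^{(m)}))^T\in\mathbb{R}^m$, and $\Gamma(X)$ is the random $m\times n$ matrix with entries $\Gamma_{ij}(X)=\gamma_j(X^{(i)})$. The random vector $\beta\in\mathbb{R}^n$ is $\beta=(\Gamma(X)^T\Gamma(X))^{-1}\Gamma(X)^TF(X)$, and $\mathrm{Cov}(\beta)=\mathbb{E}[(\beta-\mathbb{E}\beta)(\beta-\mathbb{E}\beta)^T]$. $s_1(\Gamma(X))$ is the smallest eigenvalue of $\Gamma(X)^T\Gamma(X)$.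 For $q\in[2,\infty)$, $K_q(\Gamma)=\big[\mathbb{E}\,(s_1(\Gamma(X))^{-q/2})\big]^{2/q}$, and $K_\infty(\Gamma)=\|s_1(\Gamma(X))^{-1}\|_{L^\infty}$. *)

(* Defs.v *)
From HB Require Import structures.
From mathcomp Require Export all_boot all_order all_algebra.
From mathcomp Require Export all_classical all_reals all_analysis.

Set Implicit Arguments.
Unset Strict Implicit.
Unset Printing Implicit Defensive.

Import Order.TTheory GRing.Theory Num.Theory.
Import numFieldNormedType.Exports.

Local Open Scope classical_set_scope.
Local Open Scope ring_scope.

Section iid.
Context {R : realType} {dS dT : measure_display}.
Context {S : measurableType dS} {T : measurableType dT}.
Variables (P : probability S R) (m : nat).

Definition mutually_independent (X : 'I_m -> {RV P >-> T}) : Prop :=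
  forall (J : {set 'I_m}) (A : 'I_m -> set T),
    (forall i, i \in J -> measurable (A i)) ->
    P (\bigcap_(i in [set` J]) (X i @^-1` A i)) =
      (\prod_(i in J) P (X i @^-1` A i))%E.

(* The laws are compared on measurable sets only: [distribution P (X i)] and
   [mu] may differ, as functions on all sets, outside the sigma-algebra. *)
Definition iid_sample (mu : probability T R) (X : 'I_m -> {RV P >-> T}) : Prop :=
  mutually_independent X /\
  forall i (A : set T), measurable A -> distribution P (X i) A = mu A.

End iid.

Section least_squares.
Context {R : realType} {T : Type} {n m : nat}.
Implicit Types (f : T -> R) (gamma : 'I_n -> T -> R) (a : 'cV[R]_n).
Implicit Types (x : 'I_m -> T).

Definition residue f gamma a : T -> R :=
  fun t => f t - \sum_(j < n) a j 0 * gamma j t.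

Definition observations f x : 'cV[R]_m := \col_i f (x i).

Definition design gamma x : 'M[R]_(m, n) := \matrix_(i, j) gamma j (x i).

Definition gram gamma x : 'M[R]_n := (design gamma x)^T *m design gamma x.

(* [invmx A] is [A] when [A] is singular, so this is the least squares
   estimator only where the Gram matrix is invertible. *)
Definition lsq f gamma x : 'cV[R]_n :=
  invmx (gram gamma x) *m (design gamma x)^T *m observations f x.

(* For [0 < n] the spectrum of the symmetric matrix [gram gamma x] is finite
   and nonempty, so the infimum is a minimum. *)
Definition s1 gamma x : R := inf [set a : R | eigenvalue (gram gamma x) a].

End least_squares.

Section random_vectors.
Context {R : realType} {dS : measure_display} {S : measurableType dS}.
Variables (P : probability S R) (n : nat).
Implicit Types (b : S -> 'cV[R]_n).

Definition has_mean b : Prop :=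
  forall j, P.-integrable [set: S] (fun w => (b w j 0)%:E).

Definition mean b : 'cV[R]_n := \col_j fine ('E_P[(fun w => b w j 0)%R])%E.

(* Entries are extended reals because [b] need not have second moments; the
   diagonal entries are integrals of nonnegative functions. *)
Definition Cov b : 'M[\bar R]_n :=
  \matrix_(i, j) covariance P (fun w => b w i 0) (fun w => b w j 0).

End random_vectors.

Section conditioning.
Context {R : realType} {dS : measure_display} {S : measurableType dS}.
Context {T : Type} {n m : nat}.
Variables (P : probability S R) (gamma : 'I_n -> T -> R) (X : 'I_m -> S -> T).
Local Open Scope ereal_scope.

(* The inverse is the extended real one, so that it is [+oo] where [s1] is
   zero. Only [2 <= q] is meaningful; the value at [-oo] is irrelevant. *)
Definition Kq (q : \bar R) : \bar R :=
  let s w := (s1 gamma (X ^~ w))%:E in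
  match q with
  | q'%:E => (\int[P]_w ((s w)^-1 `^ (q' / 2))) `^ (2 / q')
  | +oo => 'N[P]_+oo[(fun w => (s w)^-1)]
  | -oo => 0
  end.

End conditioning.

(* Main.v *)
Require Import Defs.
From mathcomp Require Import ring lra measurable_realfun ess_sup_inf.

Set Implicit Arguments.
Unset Strict Implicit.
Unset Printing Implicit Defensive.

Import Order.TTheory GRing.Theory Num.Theory.
Import numFieldNormedType.Exports.

Local Open Scope classical_set_scope.
Local Open Scope ring_scope.

(** Write [A] for the design matrix at the sample, [G = A^T A] for its Gram
matrix and [r] for the vector of residues of a fixed coefficient vector [a] at
the sample points.  Since the observations are [A a + r], the estimator
satisfies [beta - a = G^-1 A^T r] wherever [G] is invertible ([lsq_error]): the
error depends on [f] through the residue only.  The squared Frobenius norm of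
[G^-1 A^T] is [tr G^-1], so

  [|beta - a|^2 <= (tr G^-1) * (rho (X_1)^2 + ... + rho (X_m)^2)].

Taking [a] to be the mean of [beta] and integrating, the left side becomes the
trace of the covariance.  Each term [tr G^-1 * rho (X_i)^2] on the right is
handled by Hoelder's inequality with exponents [q/2] and [p/2]
([integral_mul_sqr_le]), and [X_i] has law [mu] ([Lnorm_law_le]).  Finally
[tr G^-1 <= n / s1] ([gram_inv_trace_le_s1]), so that the [q/2]-norm of
[tr G^-1] is at most [n * K_q].  Summing over the [m <= C n] sample points gives
the constant [C n^2 K_q].

The trace of [G^-1], rather than [1 / s1], is the quantity carried through the
integrals because it is a rational function of the sample values of [gamma], so
that its measurability is immediate.  The smallest eigenvalue only enters in the
comparison [tr G^-1 / n <= 1 / s1], and Lebesgue integrals of nonnegative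
functions, being suprema over simple functions, are monotone even when the
larger function is not known to be measurable ([le_Lnorm]).

The comparison itself does not use the spectral theorem.  Let [l] be the
largest number with [l |V|^2 <= |V A^T|^2] for all [V].  If [G - l] were
invertible, then, being positive semidefinite, it would be bounded below by a
positive multiple of the identity ([psd_unit_coercive]), and [l] would not be
the largest.  So [l] is an eigenvalue and [s1 <= l]; testing the inequality on
[V = (G^-1 A^T)^T] gives [l * tr G^-1 <= n]. *)

(** * The Frobenius norm and positive semidefinite matrices *)

Section Frobenius.
Context {R : realFieldType}.

Definition frob2 {m n} (A : 'M[R]_(m, n)) : R := \tr (A *m A^T).

Lemma frob2E m n (A : 'M[R]_(m, n)) : frob2 A = \sum_i \sum_j A i j ^+ 2.
Proof.
by apply: eq_bigr => i _; rewrite mxE; apply: eq_bigr => j _; rewrite mxE.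
Qed.

Lemma frob2_ge0 m n (A : 'M[R]_(m, n)) : 0 <= frob2 A.
Proof. by rewrite frob2E; do 2 (apply: sumr_ge0 => ? _); exact: sqr_ge0. Qed.

Lemma frob2_tr m n (A : 'M[R]_(m, n)) : frob2 A^T = frob2 A.
Proof. by rewrite /frob2 trmxK mxtrace_mulC. Qed.

(** Lagrange's identity: the defect in the inequality is half the sum of the
squares of all [a i * b j - a j * b i]. *)
Lemma cauchy_schwarz_sum (I : finType) (a b : I -> R) :
  (\sum_i a i * b i) ^+ 2 <= (\sum_i a i ^+ 2) * (\sum_i b i ^+ 2).
Proof.
suff : 0 <= \sum_i \sum_j (a i * b j - a j * b i) ^+ 2.
  have -> : \sum_i \sum_j (a i * b j - a j * b i) ^+ 2 =
      ((\sum_i a i ^+ 2) * (\sum_i b i ^+ 2)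
         - (\sum_i a i * b i) ^+ 2) *+ 2.
    rewrite expr2 !big_distrlr /= -sumrB.
    under [X in X *+ 2]eq_bigr do rewrite -sumrB.
    rewrite mulr2n [X in _ + X]exchange_big /= -big_split.
    apply: eq_bigr => i _ /=; rewrite -big_split.
    by apply: eq_bigr => j _ /=; ring.
  by rewrite pmulrn_lge0// subr_ge0.
by do 2 (apply: sumr_ge0 => ? _); exact: sqr_ge0.
Qed.

Lemma frob2_mul m n k (A : 'M[R]_(m, n)) (B : 'M[R]_(n, k)) :
  frob2 (A *m B) <= frob2 A * frob2 B.
Proof.
rewrite -(frob2_tr B) !frob2E big_distrlr /=; apply: ler_sum => i _.
apply: ler_sum => j _; rewrite mxE.
rewrite [X in _ * X](eq_bigr (fun l => B l j ^+ 2)) ?cauchy_schwarz_sum//.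
by move=> l _; rewrite mxE.
Qed.

Lemma frob2_le_unitmx m n (M : 'M[R]_n) (V : 'M[R]_(m, n)) : M \in unitmx ->
  frob2 V <= frob2 (V *m M) * frob2 (invmx M).
Proof. by move=> uM; rewrite -{1}(mulmxK uM V) frob2_mul. Qed.

(** Positivity of the quadratic form at [V - t (V M)] with [t] of the order of
[1 / K] yields [|V M|^2 <= L tr (V M V^T)] for a constant [L]; invertibility of
[M] then bounds [|V|^2] by a multiple of [|V M|^2]. *)
Lemma psd_unit_coercive m n (M : 'M[R]_n) (K : R) :
  M^T = M -> M \in unitmx ->
  (forall V : 'M[R]_(m, n), 0 <= \tr (V *m M *m V^T) <= K * frob2 V) ->
  exists2 c, 0 < c &
    forall V : 'M[R]_(m, n), c * frob2 V <= \tr (V *m M *m V^T).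
Proof.
move=> symM uM psdM.
(* [K] may be negative when there are no nonzero [V], and [F] vanishes when
   [n = 0]: the added units keep both constants positive. *)
pose L : R := `|K| + 1; have L0 : 0 < L by rewrite ltr_pwDr.
pose F : R := frob2 (invmx M) + 1.
have F0 : 0 < F by rewrite ltr_pwDr ?frob2_ge0.
exists (F * L)^-1; first by rewrite invr_gt0 mulr_gt0.
move=> V; rewrite mulrC ler_pdivrMr ?mulr_gt0//.
have VML : frob2 (V *m M) <= L * \tr (V *m M *m V^T).
  have /andP[+ _] := psdM (V - L^-1 *: (V *m M)).
  have /andP[_ KVM] := psdM (V *m M).
  have -> : \tr ((V - L^-1 *: (V *m M)) *m M *m (V - L^-1 *: (V *m M))^T) =
      \tr (V *m M *m V^T) - 2 * L^-1 * frob2 (V *m M)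
      + L^-1 ^+ 2 * \tr (V *m M *m M *m (V *m M)^T).
    have -> : (V - L^-1 *: (V *m M))^T = V^T - L^-1 *: (V *m M)^T.
      by rewrite linearB linearZ.
    rewrite !(mulmxBl, mulmxBr) -!scalemxAl -!scalemxAr.
    rewrite !(raddfB (@mxtrace R m)) /=.
    rewrite !mxtraceZ /frob2 !trmx_mul symM !mulmxA; ring.
  have := frob2_ge0 (V *m M).
  set x := frob2 _ in KVM *; set y := \tr _; set z := \tr _ in KVM *.
  move=> x0 q0.
  have zL : z <= L * x.
    by rewrite (le_trans KVM)// ler_wpM2r// /L (le_trans (ler_norm K))// lerDl.
  have : L^-1 ^+ 2 * z <= L^-1 * x.
    by rewrite expr2 -mulrA ler_pM2l ?invr_gt0// ler_pdivrMl.
  by move=> h; rewrite -ler_pdivrMl//; lra.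
rewrite (le_trans (frob2_le_unitmx V uM))// mulrC (mulrC _ (F * L)) -mulrA.
by apply: ler_pM => //; rewrite ?frob2_ge0// lerDl.
Qed.

End Frobenius.

(** * The smallest eigenvalue of a Gram matrix *)

Section normal_equations.
Context {R : realType} {m n : nat}.
Context (A : 'M[R]_(m, n)).
Let G := A^T *m A.
Let B := invmx G *m A^T.

Let symG : G^T = G. Proof. by rewrite trmx_mul trmxK. Qed.

Let symGV : (invmx G)^T = invmx G. Proof. by rewrite trmx_inv symG. Qed.

Let pinv_gram : G \in unitmx -> B *m B^T = invmx G.
Proof.
move=> uG; rewrite trmx_mul trmxK symGV mulmxA -(mulmxA _ A^T) -/G.
by rewrite mulVmx// mul1mx.
Qed.

Lemma frob2_pinv : G \in unitmx -> frob2 B = \tr (invmx G).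
Proof. by move=> uG; rewrite /frob2 pinv_gram. Qed.

(** The transpose of [B^T *m A^T] is the orthogonal projection onto the column
space of [A], which has dimension [n] as [G] is invertible. *)
Lemma frob2_hat : G \in unitmx -> frob2 (B^T *m A^T) = n%:R.
Proof.
move=> uG; rewrite -trmx_mul frob2_tr /frob2 trmx_mul mulmxA -(mulmxA A).
by rewrite pinv_gram// -mulmxA mxtrace_mulC -mulmxA -/G mulVmx// mxtrace1.
Qed.

Lemma eigenvalue_gram_ge0 a : eigenvalue G a -> 0 <= a.
Proof.
move=> /eigenvalueP[v vG v0].
have v2 : 0 < frob2 v.
  rewrite lt_neqAle frob2_ge0 andbT eq_sym; apply: contra_neq v0.
  rewrite frob2E big_ord1 => /psumr_eq0P v0; apply/rowP => j; rewrite mxE.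
  by apply/eqP; rewrite -sqrf_eq0; apply/eqP/v0 => // k _; exact: sqr_ge0.
have : 0 <= a * frob2 v.
  rewrite /frob2 -mxtraceZ scalemxAl -vG mulmxA -mulmxA -{2}(trmxK A).
  by rewrite -trmx_mul frob2_ge0.
by rewrite pmulr_lge0.
Qed.

(** The constants of coercivity of the quadratic form of [G]; letting [V] range
over matrices rather than row vectors allows testing on [B^T] directly. *)
Let coercive :=
  [set a : R | forall V : 'M[R]_(m, n), a * frob2 V <= frob2 (V *m A^T)].

(** The largest constant of coercivity of [G] is an eigenvalue: otherwise
[G - l%:M] would be invertible and [psd_unit_coercive] would improve [l]. *)
Lemma inf_eigenvalue_mul_tr_invmx : (0 < n)%N -> G \in unitmx ->
  inf [set a | eigenvalue G a] * \tr (invmx G) <= n%:R.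
Proof.
move=> n0 uG; rewrite -frob2_pinv//.
have B0 : 0 < frob2 B.
  rewrite lt_neqAle frob2_ge0 andbT eq_sym; apply/eqP => B0.
  have := frob2_mul B^T A^T; rewrite frob2_hat// frob2_tr B0 mul0r.
  by rewrite leNgt ltr0n n0.
have ubE : ubound coercive (n%:R / frob2 B).
  by move=> a /(_ B^T); rewrite frob2_hat// frob2_tr ler_pdivlMr.
have E0 : coercive 0 by move=> V; rewrite mul0r frob2_ge0.
have supE : has_sup coercive by split; [exists 0|exists (n%:R / frob2 B)].
have lE : coercive (sup coercive).
  move=> V; have := frob2_ge0 V; rewrite le_eqVlt => /predU1P[<-|V0].
    by rewrite mulr0 frob2_ge0.
  rewrite -ler_pdivlMr//; apply: ge_sup; first by exists 0.
  by move=> a /(_ V); rewrite ler_pdivlMr.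
set l := sup coercive in lE *.
apply: (@le_trans _ _ (l * frob2 B)); last first.
  by have := lE B^T; rewrite frob2_hat// frob2_tr.
rewrite ler_wpM2r ?frob2_ge0//; apply: ge_inf.
  by exists 0 => a; exact: eigenvalue_gram_ge0.
rewrite /= /eigenvalue /eigenspace kermx_eq0 row_free_unit; apply/negP => uM.
have trM (V : 'M[R]_(m, n)) :
    \tr (V *m (G - l%:M) *m V^T) = frob2 (V *m A^T) - l * frob2 V.
  rewrite mulmxBr mulmxBl linearB /= mul_mx_scalar -scalemxAl mxtraceZ.
  by rewrite /frob2 trmx_mul trmxK !mulmxA.
have [|//|V|c c0 cM] := @psd_unit_coercive R m n (G - l%:M) (frob2 A).
- by rewrite linearB /= symG tr_scalar_mx.
- rewrite trM subr_ge0 lE /= lerBlDr (le_trans (frob2_mul _ _))// frob2_tr.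
  rewrite mulrC lerDl mulr_ge0 ?frob2_ge0// ub_le_sup//.
  by exists (n%:R / frob2 B).
have : l + c <= l.
  apply: ub_le_sup; first by exists (n%:R / frob2 B).
  by move=> V; have := cM V; rewrite trM mulrDl lerBrDl.
by rewrite gerDl leNgt c0.
Qed.

(** When [n = 0] there is no eigenvalue, and [inf set0 = 0]. *)
Lemma inf_eigenvalue_gram_ge0 : 0 <= inf [set a | eigenvalue G a].
Proof.
have [[a Ga]|/nonemptyPn ->] := pselect ([set a | eigenvalue G a] !=set0).
  by apply: lb_le_inf; [exists a|exact: eigenvalue_gram_ge0].
by rewrite inf0.
Qed.

End normal_equations.

(** * Measurability of determinants and adjugates *)

Section matrix_measurability.
Context {R : realType} {d : measure_display} {S : measurableType d}.

(** [x^-1 = x * (x ^+ 2)^-1] reduces inversion on the line to a real power of a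
nonnegative number; at [x = 0] both sides are [0]. *)
Lemma measurable_funV (f : S -> R) :
  measurable_fun setT f -> measurable_fun setT (fun w => (f w)^-1).
Proof.
move=> mf.
have -> : (fun w => (f w)^-1) = (fun w => f w * (f w ^+ 2) `^ (- 1)).
  apply/funext => w; rewrite powR_inv1 ?sqr_ge0//.
  have [->|f0] := eqVneq (f w) 0; first by rewrite invr0 mul0r.
  by rewrite expr2 invfM mulrA divff// mul1r.
apply: measurable_funM => //.
apply: (@measurableT_comp _ _ _ _ _ _ (@powR R ^~ (- 1))) => //.
exact: measurable_funX.
Qed.

Lemma measurable_det n (M : S -> 'M[R]_n) :
  (forall i j, measurable_fun setT (fun w => M w i j)) ->
  measurable_fun setT (fun w => \det (M w)).
Proof.
move=> mM; apply: measurable_sum => s; apply: measurable_funM => //.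
by apply: measurable_prod => i _; exact: mM.
Qed.

Lemma measurable_adj n (M : S -> 'M[R]_n) i j :
  (forall i j, measurable_fun setT (fun w => M w i j)) ->
  measurable_fun setT (fun w => (\adj (M w)) i j).
Proof.
move=> mM; under eq_fun do rewrite mxE.
apply: measurable_funM => //; apply: measurable_det => k l.
by under eq_fun do rewrite !mxE; exact: mM.
Qed.

End matrix_measurability.

(** * Norms of functions on a probability space *)

Section Lnorm_extra.
Context {R : realType} {d : measure_display} {S : measurableType d}.
Context (P : probability S R).
Local Open Scope ereal_scope.

Lemma probability_setT_gt0 : 0 < P [set: S].
Proof. by rewrite probability_setT lte01. Qed.

(** The integral of a nonnegative function is a supremum over the simple functions
below it, and an essential supremum is monotone by definition; hence the
functions are arbitrary here, which lets [g] be the inverse of the smallest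
eigenvalue. *)
Lemma le_Lnorm (p : \bar R) (f g : S -> \bar R) : 0 < p ->
  (forall w, 0 <= f w <= g w) -> 'N[P]_p[f] <= 'N[P]_p[g].
Proof.
move=> p0 fg.
have f0 w : 0 <= f w by have /andP[] := fg w.
have {}fg w : f w <= g w by have /andP[] := fg w.
have afg w : `|f w| <= `|g w| by rewrite !gee0_abs// (le_trans (f0 w)).
rewrite unlock; case: p p0 => [p p0|_|//]; last first.
  by rewrite probability_setT_gt0; apply: le_ess_sup; exact: nearW.
have pge : (0 <= p)%R by rewrite ltW.
apply: gt0_ler_poweR; rewrite ?invr_ge0// ?in_itv/= ?leey ?andbT.
1,2: by apply: integral_ge0 => w _; exact: poweR_ge0.
rewrite !ge0_integralTE => [|w|w]; try exact: poweR_ge0.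
apply: le_ereal_sup => _ [h hf <-]; exists h => // w.
apply: le_trans (hf w) _; apply: gt0_ler_poweR => //.
all: by rewrite in_itv/= abse_ge0 leey.
Qed.

Lemma Lnorm_sqr (p : \bar R) (f : S -> R) : 0 < p ->
  'N[P]_(p * (2^-1)%:E)[EFin \o (fun w => f w ^+ 2)%R] =
  'N[P]_p[EFin \o f] ^+ 2.
Proof.
rewrite expe2 unlock; case: p => [p|_|//].
  rewrite lte_fin => p0; rewrite -EFinM /=.
  under eq_integral do
    rewrite normrX -powR_mulrn// -powRrM mulrCA mulfV// mulr1.
  rewrite invfM invrK poweRrM.
  have : 0 <= (\int[P]_x (`|f x| `^ p)%:E) `^ p^-1 by exact: poweR_ge0.
  case: (_ `^ _) => [x|_|//]; last by rewrite /= pnatr_eq0.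
  by rewrite lee_fin poweR_EFin => x0; rewrite powR_mulrn// expr2 EFinM.
rewrite gt0_mulye ?lte_fin// probability_setT_gt0.
set E := ess_sup P _; set F := ess_sup P (abse \o (EFin \o f)).
have F0 : 0 <= F.
  apply: (ess_sup_gee probability_setT_gt0).
  by apply: nearW => x; exact: abse_ge0.
apply/eqP; rewrite eq_le; apply/andP; split.
  apply/ess_supP; have : \forall x \ae P, (abse \o (EFin \o f)) x <= F.
    exact: ess_sup_ge.
  apply: filterS => x /= fF.
  by rewrite normrX expr2 EFinM lee_pmul.
have E0 : 0 <= E.
  apply: (ess_sup_gee probability_setT_gt0).
  by apply: nearW => x; exact: abse_ge0.
suff FE : F <= sqrte E by rewrite -[leRHS]sqr_sqrte// expe2 lee_pmul.
apply/ess_supP; have : \forall x \ae P,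
  (abse \o (EFin \o (fun w => f w ^+ 2)%R)) x <= E by exact: ess_sup_ge.
apply: filterS => x /= fE.
rewrite -lee_sqrt// in fE.
by rewrite (le_trans _ fE)//= normrX sqrtr_sqr normr_id.
Qed.

(** At the endpoints, where the exponents are [1] and [+oo], one factor is almost
everywhere at most its essential supremum, which comes out of the integral. *)
Lemma ehoelder (f g : S -> R) (p q : \bar R) :
  measurable_fun setT f -> measurable_fun setT g ->
  0 < p -> 0 < q -> p^-1 + q^-1 = 1 ->
  'N[P]_1[EFin \o (f \* g)%R] <= 'N[P]_p[EFin \o f] * 'N[P]_q[EFin \o g].
Proof.
move=> mf mg.
have ess (u v : S -> R) : measurable_fun setT u -> measurable_fun setT v ->
    'N[P]_1[EFin \o (u \* v)%R] <= 'N[P]_+oo[EFin \o u] * 'N[P]_1[EFin \o v].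
  move=> mu mv; rewrite !Lnorm1; set M := 'N[P]_+oo[_].
  have M0 : 0 <= M by exact: Lnorm_ge0.
  have mav : measurable_fun setT (abse \o (EFin \o v)).
    by apply: measurableT_comp => //; exact/measurable_EFinP.
  rewrite -ge0_integralZl//; apply: ae_ge0_le_integral => //.
  - by apply: measurableT_comp => //; apply/measurable_EFinP/measurable_funM.
  - by move=> x _; rewrite mule_ge0.
  - exact: emeasurable_funM.
  have : \forall x \ae P, (abse \o (EFin \o u)) x <= M.
    by rewrite /M unlock probability_setT_gt0; exact: ess_sup_ge.
  apply: filterS => x /= uM _.
  by rewrite normrM EFinM lee_pmul.
case: p => [p| |//]; case: q => [q| |//] p0 q0.
- rewrite !lte_fin in p0 q0; rewrite !inver !gt_eqF// -EFinD => -[pq].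
  exact: hoelder.
- rewrite invey adde0 => /eqP; rewrite inve_eq1 => /eqP ->.
  rewrite muleC (_ : (f \* g)%R = (g \* f)%R); first exact: ess.
  by apply/funext => x /=; rewrite mulrC.
- by rewrite invey add0e => /eqP; rewrite inve_eq1 => /eqP ->; exact: ess.
- by rewrite !invey add0e => /eqP; rewrite eq_sym onee_eq0.
Qed.

(** The conditions [1/(p/2) + 1/(q/2) = 1] and [2/p + 2/q = 1] agree also at
[+oo], where both terms are [0]. *)
Let half_conj (r : \bar R) : 0 < r -> 2%:E * r^-1 = (r * (2^-1)%:E)^-1.
Proof.
case: r => [r|_|//]; last by rewrite gt0_mulye ?lte_fin// invey mule0.
rewrite lte_fin => r0; rewrite -EFinM !inver !gt_eqF ?divr_gt0//.
by rewrite -EFinM invfM invrK mulrC.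
Qed.

Lemma integral_mul_sqr_le (u v : S -> R) (p q : \bar R) :
  measurable_fun setT u -> measurable_fun setT v -> (forall w, (0 <= u w)%R) ->
  0 < p -> 0 < q -> 2%:E * p^-1 + 2%:E * q^-1 = 1 ->
  \int[P]_w (u w * v w ^+ 2)%:E <=
    'N[P]_(q * (2^-1)%:E)[EFin \o u] * 'N[P]_p[EFin \o v] ^+ 2.
Proof.
move=> mu mv u0 p0 q0; rewrite !half_conj// addeC => pq.
have half_gt0 (r : \bar R) : 0 < r -> 0 < r * (2^-1)%:E.
  by move=> r0; rewrite mule_gt0// lte_fin.
rewrite -(Lnorm_sqr v)//.
have := ehoelder mu (measurable_funX 2 mv) (half_gt0 _ q0) (half_gt0 _ p0) pq.
rewrite Lnorm1; congr (_ <= _); apply: eq_integral => w _ /=.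
by rewrite ger0_norm// mulr_ge0// sqr_ge0.
Qed.

End Lnorm_extra.

Section law.
Context {R : realType} {dS dT : measure_display}.
Context {S : measurableType dS} {T : measurableType dT}.
Context (P : probability S R) (mu : probability T R) (X : {RV P >-> T}).
Local Open Scope ereal_scope.

(** For finite [p] the integrals agree by the change of variables formula; for
[p = +oo] the preimage under [X] of a null set of [mu] is a null set of [P]. *)
Lemma Lnorm_law_le (p : \bar R) (f : T -> R) :
  (forall A, measurable A -> distribution P X A = mu A) ->
  0 < p -> measurable_fun setT f ->
  'N[P]_p[EFin \o (f \o X)] <= 'N[mu]_p[EFin \o f].
Proof.
move=> law + mf; rewrite unlock; case: p => [p|_|//].
  rewrite lte_fin => p0 /=.
  rewrite le_eqVlt; apply/orP; left; apply/eqP; congr (_ `^ _).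
  rewrite -(@ge0_integral_distribution _ _ _ _ _ _ X
    (fun t => (`|f t| `^ p)%:E)).
  - by apply: eq_measure_integral => A mA _; exact: law.
  - apply/measurable_EFinP.
    apply: (@measurableT_comp _ _ _ _ _ _ (@powR R ^~ p)) => //.
    exact: measurableT_comp.
  - by move=> t; rewrite lee_fin powR_ge0.
rewrite !probability_setT_gt0; apply/ess_supP.
have [N [mN N0 fN]] : \forall x \ae mu,
  (abse \o (EFin \o f)) x <= ess_sup mu (abse \o (EFin \o f)).
  exact: ess_sup_ge.
exists (X @^-1` N); split.
- by rewrite -[X in measurable X]setTI; exact: measurable_funP.
- by rewrite -[LHS]/(distribution P X N) law.
- by move=> w /= Xw; apply: fN.
Qed.

End law.

(** * The error of the least squares estimator *)

Section estimator.
Context {R : realType} {T : Type} {n m : nat}.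
Context (gamma : 'I_n -> T -> R) (x : 'I_m -> T).
Let G := gram gamma x.

(** The trace of the inverse Gram matrix, written with Cramer's rule so that it
is visibly measurable in [x], and equal to [0] at singular Gram matrices, since
[0^-1 = 0]; thus [gram_inv_trace_le_s1] holds at every sample. *)
Definition gram_inv_trace : R := (\det G)^-1 * \tr (\adj G).

Lemma gram_inv_traceE : G \in unitmx -> gram_inv_trace = \tr (invmx G).
Proof. by move=> uG; rewrite /gram_inv_trace /invmx uG mxtraceZ. Qed.

Lemma gram_inv_trace0 : G \notin unitmx -> gram_inv_trace = 0.
Proof.
by rewrite unitmxE unitfE negbK /gram_inv_trace => /eqP ->; rewrite invr0 mul0r.
Qed.

Lemma gram_inv_trace_ge0 : 0 <= gram_inv_trace.
Proof.
have [uG|/gram_inv_trace0 ->//] := boolP (G \in unitmx).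
by rewrite gram_inv_traceE// -frob2_pinv// frob2_ge0.
Qed.

Lemma s1_ge0 : 0 <= s1 gamma x.
Proof. exact: inf_eigenvalue_gram_ge0. Qed.

Lemma gram_inv_trace_le_s1 : (0 < n)%N ->
  ((gram_inv_trace / n%:R)%:E <= (s1 gamma x)%:E^-1)%E.
Proof.
move=> n0; rewrite inver; case: ifPn => [_|s0]; first exact: leey.
have {}s0 : 0 < s1 gamma x by rewrite lt_neqAle eq_sym s0 s1_ge0.
rewrite lee_fin ler_pdivrMr ?ltr0n// ler_pdivlMl//.
have [uG|/gram_inv_trace0 ->] := boolP (G \in unitmx); last by rewrite mulr0.
by rewrite gram_inv_traceE//; exact: inf_eigenvalue_mul_tr_invmx.
Qed.

(** The observations are [design gamma x *m a] plus the residues, and the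
estimator inverts the design matrix exactly, so that [lsq f gamma x - a] is the
pseudo-inverse of the design matrix applied to the residues. *)
Lemma lsq_error f (a : 'cV[R]_n) : G \in unitmx ->
  \sum_j (lsq f gamma x j 0 - a j 0) ^+ 2 <=
  gram_inv_trace * \sum_i residue f gamma a (x i) ^+ 2.
Proof.
move=> uG; rewrite gram_inv_traceE// -frob2_pinv//.
pose r : 'cV[R]_m := \col_i residue f gamma a (x i).
have col2 k (v : 'cV[R]_k) : frob2 v = \sum_i v i 0 ^+ 2.
  by rewrite frob2E; apply: eq_bigr => i _; rewrite big_ord1.
have obs : observations f x = design gamma x *m a + r.
  apply/colP => i; rewrite !mxE /residue addrC -addrA.
  under [X in _ = _ + (_ + X)]eq_bigr do rewrite mxE mulrC.
  by rewrite addNr addr0.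
have -> : \sum_i residue f gamma a (x i) ^+ 2 = frob2 r.
  by rewrite col2; apply: eq_bigr => i _; rewrite mxE.
have -> : \sum_j (lsq f gamma x j 0 - a j 0) ^+ 2 = frob2 (lsq f gamma x - a).
  by rewrite col2; apply: eq_bigr => i _; rewrite !mxE.
suff -> : lsq f gamma x - a = invmx G *m (design gamma x)^T *m r.
  exact: frob2_mul.
rewrite /lsq obs mulmxDr addrAC mulmxA -(mulmxA (invmx _)).
by rewrite -[_ *m design _ _]/G mulVmx// mul1mx subrr add0r.
Qed.

End estimator.

Lemma measurable_gram_inv_trace {R : realType} {dS dT : measure_display}
    {S : measurableType dS} {T : measurableType dT} (n m : nat)
    (gamma : 'I_n -> T -> R) (X : 'I_m -> S -> T) :
  (forall j, measurable_fun setT (gamma j)) ->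
  (forall i, measurable_fun setT (X i)) ->
  measurable_fun setT (fun w => gram_inv_trace gamma (X ^~ w)).
Proof.
move=> mgamma mX.
have mG i j : measurable_fun setT (fun w => gram gamma (X ^~ w) i j).
  under eq_fun do rewrite mxE.
  apply: measurable_sum => k; under eq_fun do rewrite !mxE.
  by apply: measurable_funM; exact: measurableT_comp.
apply: measurable_funM; first exact/measurable_funV/measurable_det.
by apply: measurable_sum => i; exact: measurable_adj.
Qed.

Lemma KqE {R : realType} {dS : measure_display} {S : measurableType dS}
    (T : Type) (n m : nat) (P : probability S R) (gamma : 'I_n -> T -> R)
    (X : 'I_m -> S -> T) (q : \bar R) : (0 < q)%E ->
  (Kq P gamma X q =
   'N[P]_(q * (2^-1)%:E)[(fun w => (s1 gamma (X ^~ w))%:E^-1)])%E.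
Proof.
case: q => [q|_|//]; last by rewrite gt0_mulye// lte_fin.
rewrite lte_fin => q0; rewrite -EFinM unlock /= invfM invrK (mulrC q^-1).
congr (_ `^ _)%E.
apply: eq_integral => w _; rewrite gee0_abs//.
by rewrite inve_ge0 lee_fin s1_ge0.
Qed.

(** * The variance bound *)

Theorem proposition3p4 (R : realType) :
  exists Cn : nat -> R -> R -> R,
  forall (n m : nat) (C : R) (dS dT : measure_display)
    (S : measurableType dS) (Omega : measurableType dT)
    (P : probability S R) (mu : probability Omega R)
    (f : Omega -> R) (gamma : 'I_n -> Omega -> R)
    (X : 'I_m -> {RV P >-> Omega}) (p q : \bar R),
  let beta w := lsq f gamma (fun i => X i w) in
  let rho := residue f gamma (mean P beta) in
  (0 < n)%N -> (0 < m)%N ->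
  measurable_fun [set: Omega] f ->
  (forall j, measurable_fun [set: Omega] (gamma j)) ->
  iid_sample mu X ->
  {ae P, forall w, gram gamma (fun i => X i w) \in unitmx} ->
  has_mean P beta ->
  m%:R <= C * n%:R ->
  (2%:E <= p)%E -> (2%:E <= q)%E ->
  (2%:E * p^-1 + 2%:E * q^-1 = 1)%E ->
  rho \in Lfun mu p ->
  (Kq P gamma X q < +oo)%E ->
  (\tr (Cov P beta) <=
     (Cn n C (fine (Kq P gamma X q)))%:E * 'N[mu]_p[EFin \o rho] ^+ 2)%E.
Proof.
(* One factor [n] comes from [m <= C * n], the other from [n / s1]. *)
exists (fun n C K => C * n%:R * (n%:R * K)).
move=> n m C dS dT S Omega P mu f gamma X p q beta rho n0 _ mf mgamma [_ law].
move=> unitG meanbeta mC p2 q2 pq _ Kfin.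
have p0 : (0 < p)%E by apply: lt_le_trans p2; rewrite lte_fin.
have q0 : (0 < q)%E by apply: lt_le_trans q2; rewrite lte_fin.
have mrho : measurable_fun setT rho.
  apply: measurable_funB => //; apply: measurable_sum => j.
  exact: measurable_funM.
(* Dividing the trace by [n] on this side of the comparison with [1 / s1] leaves
   the norm of [1 / s1] as it stands in [K], with nothing to factor out of the
   integral of a function that may fail to be measurable. *)
pose tau w := gram_inv_trace gamma (fun i => X i w) / n%:R.
have mtau : measurable_fun setT tau.
  apply: measurable_funM => //.
  exact: (measurable_gram_inv_trace (X := fun i w => X i w)).
have tau0 w : 0 <= tau w by rewrite divr_ge0// gram_inv_trace_ge0.
have mrhoX i : measurable_fun setT (fun w => rho (X i w) ^+ 2).
  by apply: measurable_funX; exact: measurableT_comp.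
have taurho0 i w : 0 <= tau w * rho (X i w) ^+ 2.
  by rewrite mulr_ge0// sqr_ge0.
set K := Kq P gamma X q in Kfin *.
set N := 'N[mu]_p[_]%E.
have K0 : (0 <= K)%E by rewrite /K KqE// Lnorm_ge0.
have step i : (\int[P]_w (tau w * rho (X i w) ^+ 2)%:E <= K * N ^+ 2)%E.
  have mrX : measurable_fun setT (rho \o X i) by exact: measurableT_comp.
  apply: (le_trans (integral_mul_sqr_le P mtau mrX tau0 p0 q0 pq)).
  have half_gt0 : (0 < q * (2^-1)%:E)%E by rewrite mule_gt0// lte_fin.
  apply: lee_pmul; rewrite ?expe2 ?mule_ge0 ?Lnorm_ge0//.
    rewrite /K KqE//; apply: le_Lnorm => // w.
    by rewrite lee_fin tau0 gram_inv_trace_le_s1.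
  by apply: lee_pmul; rewrite ?Lnorm_ge0//; exact: (Lnorm_law_le (law i)).
pose err j w := (beta w j 0 - mean P beta j 0) ^+ 2.
have merr j : measurable_fun setT (err j).
  apply: measurable_funX; apply: measurable_funB => //.
  exact/measurable_EFinP/(measurable_int P)/meanbeta.
have -> : (\tr (Cov P beta) = \sum_j \int[P]_w (err j w)%:E)%E.
  apply: eq_bigr => j _; rewrite mxE unlock unlock.
  have meanE : mean P beta j 0 = fine (\int[P]_w (beta w j 0)%:E)%E.
    by rewrite mxE unlock.
  by apply: eq_integral => w _; rewrite /err meanE expr2.
rewrite -ge0_integral_sum//; last 2 first.
- by move=> j; exact/measurable_EFinP.
- by move=> j w _; rewrite lee_fin sqr_ge0.
apply: (@le_trans _ _
  (\int[P]_w \sum_i (n%:R * (tau w * rho (X i w) ^+ 2))%:E)%E).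
  apply: ae_ge0_le_integral => //.
  - by move=> w _; apply: sume_ge0 => j _; rewrite lee_fin sqr_ge0.
  - by apply: emeasurable_sum => j; exact/measurable_EFinP.
  - move=> w _; apply: sume_ge0 => i _.
    by rewrite lee_fin mulr_ge0.
  - apply: emeasurable_sum => i; apply/measurable_EFinP.
    by apply: measurable_funM => //; exact: measurable_funM.
  apply: filterS unitG => w uG _.
  rewrite !sumEFin lee_fin.
  have -> : \sum_i n%:R * (tau w * rho (X i w) ^+ 2) =
      gram_inv_trace gamma (fun i => X i w) * \sum_i rho (X i w) ^+ 2.
    rewrite mulr_sumr; apply: eq_bigr => i _; rewrite mulrA mulrC /tau.
    by rewrite [n%:R * _]mulrC divfK ?pnatr_eq0 -?lt0n// mulrC.
  exact: lsq_error.
rewrite ge0_integral_sum//; last 2 first.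
- move=> i; apply/measurable_EFinP.
  by apply: measurable_funM => //; exact: measurable_funM.
- by move=> i w _; rewrite lee_fin mulr_ge0.
apply: (@le_trans _ _ (\sum_(i < m) n%:R%:E * (K * N ^+ 2))%E).
  apply: lee_sum => i _; under eq_integral do rewrite EFinM.
  rewrite ge0_integralZl//; first last.
  - by move=> w _; rewrite lee_fin.
  - by apply/measurable_EFinP; exact: measurable_funM.
  apply: lee_pmul; rewrite ?lee_fin// integral_ge0// => w _.
  by rewrite lee_fin.
have Kfn : K \is a fin_num by rewrite ge0_fin_numE.
rewrite -{1}(fineK Kfn) muleA -EFinM.
have N20 : (0 <= N ^+ 2)%E by rewrite expe2 mule_ge0// Lnorm_ge0.
have -> : (\sum_(i < m) (n%:R * fine K)%:E * N ^+ 2 =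
    (m%:R * (n%:R * fine K))%:E * N ^+ 2)%E.
  rewrite -ge0_sume_distrl; last first.
    by move=> i _; rewrite lee_fin mulr_ge0// fine_ge0.
  by rewrite sumEFin sumr_const card_ord -(mulr_natl (_ * _)).
have nK0 : 0 <= n%:R * fine K by rewrite mulr_ge0// fine_ge0.
apply: lee_pmul => //; first by rewrite lee_fin mulr_ge0.
by rewrite lee_fin ler_wpM2r.
Qed.
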